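(* There is a positive constant $c$ such that for all integers $n\ge 20$, $$ D(n)<1-\frac{c}{(\log\log n)^{1-\frac{1}{2}{\rm e}\log 2}\sqrt{\log\log\log n}}. $$
   Context: For a positive integer $n$, a set $S\subseteq \mathbb{Z}/n\mathbb{Z}$ is called product-free if there are no $a,b,c\in S$ (not necessarily distinct) with $ab\equiv c \pmod n$. For such $S$ let $D(S)=|S|/n$, and let $D(n)$ denote the maximum of $D(S)$ over all product-free sets $S\subseteq\mathbb{Z}/n\mathbb{Z}$. Here $\log$ is the natural logarithm and ${\rm e}$ is Euler's number. *)

(* Defs.v *)
From mathcomp Require Import all_boot all_order all_algebra.
From mathcomp Require Import all_classical all_reals all_analysis.

Set Implicit Arguments.
Unset Strict Implicit.
Unset Printing Implicit Defensive.

Import Order.TTheory GRing.Theory Num.Theory.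
Local Open Scope ring_scope.

(* Z/nZ is represented by its residues 'I_n, which, unlike 'Z_n, has exactly
   n elements for every n > 0. *)
Definition product_free (n : nat) (S : {set 'I_n}) : bool :=
  [forall a in S, forall b in S, forall c in S, (a * b != c %[mod n])%N].

Definition density (R : realType) (n : nat) (S : {set 'I_n}) : R :=
  #|S|%:R / n%:R.

(* The default value 0 does not affect the maximum: it is the density of the
   empty set, which is product-free. *)
Definition max_density (R : realType) (n : nat) : R :=
  \big[Num.max/0]_(S : {set 'I_n} | product_free S) density R S.

(* Main.v *)
Require Import Defs.
From mathcomp Require Import all_boot all_order all_algebra.
From mathcomp Require Import all_classical unstable all_reals all_analysis.
From mathcomp Require Import zify ring lra.
(* restores the finite-set names shadowed by [classical_sets] *)
From mathcomp Require Import fintype finset.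

Set Implicit Arguments.
Unset Strict Implicit.
Unset Printing Implicit Defensive.

Import Order.TTheory GRing.Theory Num.Theory.
Local Open Scope ring_scope.

(* Let T be the complement of a product-free set S modulo n. For a set D of
   prime divisors of n with product d, the map u |-> d u from the units to the
   residues of gcd d with n has fibres of size at most d, so if d u lies outside
   S for at least half of the units u ("S is sparse at d") then T contains at
   least phi(n) / (2 d) residues of gcd d. If D and D' are disjoint and S is
   sparse neither at d nor at d', some d u0 lies in S, and S being product-free
   then forces it to be sparse at d d'. Split a random 2k-set of prime divisors,
   drawn with weight 1/d, into two k-sets: S is sparse at one of the halves or
   at the whole. Hence C e_2k phi(n) <= 2 |T| (C + 2 e_k), where C is the
   binomial coefficient of 2k and k, and e_j the j-th elementary symmetric
   function of the 1/p, p | n. If lam is the sum of the 1/p, then e_j is at most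
   lam^j / j!, and at least a constant times that for j <= 7/5 lam. It follows
   that |T| / phi(n) is at least a constant times the smaller of lam^k / k! and
   lam^2k / (2k)!. With k ~ (e/4) lam and Stirling's formula this bounds |T| / n
   below by a constant times exp (- (1 - (e/2) log 2) lam) / sqrt lam, since
   phi(n) / n is at least exp (- lam - 1); and lam is at most
   log log log n + O(1) by Mertens' theorem. *)

(** * Elementary symmetric functions *)

Section ElementarySymmetric.
Variables (R : realDomainType) (I : finType) (y : I -> R).
Hypothesis y_ge0 : forall i, 0 <= y i.
Implicit Types (D E : {set I}) (B : pred {set I}).

Definition setweight D : R := \prod_(i in D) y i.

Definition elemsym (k : nat) : R := \sum_(D : {set I} | #|D| == k) setweight D.

Definition elemsym_on B (k : nat) : R :=
  \sum_(D : {set I} | (#|D| == k) && B D) setweight D.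

Lemma setweight_ge0 D : 0 <= setweight D.
Proof. exact: prodr_ge0. Qed.

Lemma elemsym_ge0 k : 0 <= elemsym k.
Proof. by apply: sumr_ge0 => D _; exact: setweight_ge0. Qed.

Lemma elemsym0 : elemsym 0 = 1.
Proof.
rewrite /elemsym (big_pred1 set0) => [|D]; last by rewrite cards_eq0.
by rewrite /setweight big_set0.
Qed.

Lemma setweightU1 i D : i \notin D -> setweight (i |: D) = y i * setweight D.
Proof. by move=> iD; rewrite /setweight big_setU1. Qed.

Lemma setweight_setID D E : D \subset E ->
  setweight E = setweight D * setweight (E :\: D).
Proof. by move=> DE; rewrite /setweight (big_setID D) (setIidPr DE). Qed.

Lemma exchange_sum_setD1 k (F : {set I} -> I -> R) :
  \sum_(E : {set I} | #|E| == k.+1) \sum_(i in E) F (E :\ i) i =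
  \sum_(D : {set I} | #|D| == k) \sum_(i in ~: D) F D i.
Proof.
rewrite (exchange_big_dep xpredT) //= [RHS](exchange_big_dep xpredT) //=.
apply: eq_bigr => i _.
rewrite (reindex_onto (fun D => i |: D) (fun E => E :\ i)) /=; last first.
  by move=> E /andP[_ iE]; rewrite setD1K.
apply: eq_big => [D|D /andP[_ /eqP ->] //].
rewrite !inE eqxx /= andbT cardsU1.
have [iD|iD] /= := boolP (i \in D); last by rewrite add1n eqSS setU1K // eqxx.
by rewrite andbF; apply/andP => -[_ /eqP E]; rewrite -E !inE eqxx in iD.
Qed.

Lemma elemsymS k : k.+1%:R * elemsym k.+1 =
  \sum_(D : {set I} | #|D| == k) \sum_(i in ~: D) setweight D * y i.
Proof.
rewrite -(exchange_sum_setD1 k (fun D i => setweight D * y i)) big_distrr /=.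
apply: eq_bigr => E /eqP cE.
rewrite (eq_bigr (fun=> setweight E)) => [|i iE]; last first.
  by rewrite mulrC -setweightU1 ?setD1K // !inE eqxx.
by rewrite sumr_const cE mulr_natl.
Qed.

Lemma elemsym_sumM k : (\sum_i y i) * elemsym k =
  \sum_(D : {set I} | #|D| == k) \sum_(i in ~: D) setweight D * y i +
  \sum_(D : {set I} | #|D| == k) \sum_(i in D) setweight D * y i.
Proof.
rewrite -big_split /= big_distrr /=; apply: eq_bigr => D _.
rewrite mulrC big_distrr /= (bigID (mem D)) /= addrC.
by congr (_ + _); apply: eq_bigl => i; rewrite inE.
Qed.

Lemma elemsymS_le k : k.+1%:R * elemsym k.+1 <= (\sum_i y i) * elemsym k.
Proof.
rewrite elemsymS elemsym_sumM lerDl; apply: sumr_ge0 => D _.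
by apply: sumr_ge0 => i _; rewrite mulr_ge0 // setweight_ge0.
Qed.

Lemma elemsymSS_ge k :
  (\sum_i y i) * elemsym k.+1 - (\sum_i y i ^+ 2) * elemsym k <=
  k.+2%:R * elemsym k.+2.
Proof.
rewrite elemsymS elemsym_sumM lerBlDr lerD2l.
have -> : \sum_(E : {set I} | #|E| == k.+1) \sum_(i in E) setweight E * y i =
    \sum_(D : {set I} | #|D| == k) \sum_(i in ~: D) setweight D * y i ^+ 2.
  rewrite -(exchange_sum_setD1 k (fun D i => setweight D * y i ^+ 2)).
  apply: eq_bigr => E _; apply: eq_bigr => i iE.
  by rewrite -{1}(setD1K iE) setweightU1 ?inE ?eqxx //; ring.
rewrite mulrC big_distrl /=; apply: ler_sum => D _.
rewrite big_distrr /= [leRHS](bigID (mem (~: D))) /= lerDl.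
by apply: sumr_ge0 => i _; rewrite mulr_ge0 ?setweight_ge0 // exprn_ge0.
Qed.

Lemma elemsym1 : elemsym 1 = \sum_i y i.
Proof.
have := elemsymS 0; rewrite mul1r => ->.
rewrite (big_pred1 set0) => [|D]; last by rewrite cards_eq0.
by apply: eq_big => [i|i _]; rewrite ?inE // /setweight big_set0 mul1r.
Qed.

Lemma fact_elemsym_le k : k`!%:R * elemsym k <= (\sum_i y i) ^+ k.
Proof.
have s_ge0 : 0 <= \sum_i y i by exact: sumr_ge0.
elim: k => [|k IH]; first by rewrite elemsym0 fact0 mulr1.
rewrite factS mulnC natrM -mulrA exprS.
apply: le_trans (ler_wpM2l (ler0n _ _) (elemsymS_le k)) _.
by rewrite mulrCA ler_wpM2l.
Qed.

Lemma fact_elemsym_ge k :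
  (\sum_i y i) ^+ k
    - 'C(k, 2)%:R * (\sum_i y i ^+ 2) * (\sum_i y i) ^+ (k - 2)
  <= k`!%:R * elemsym k.
Proof.
set s := \sum_i y i; set q := \sum_i y i ^+ 2.
have s_ge0 : 0 <= s by exact: sumr_ge0.
have q_ge0 : 0 <= q by apply: sumr_ge0 => i _; exact: exprn_ge0.
have binM_expr m :
    'C(m.+1, 2)%:R * s * s ^+ (m.+1 - 2) = 'C(m.+1, 2)%:R * s ^+ m.
  case: m => [|m]; first by rewrite bin_small // !mul0r.
  by rewrite !subSS subn0 -mulrA -exprS.
elim: k => [|[|k] IH].
- by rewrite elemsym0 fact0 bin_small // !mul0r subr0 mulr1.
- by rewrite elemsym1 bin_small // !mul0r subr0 mul1r.
have recur := ler_wpM2l (ler0n R k.+1`!) (elemsymSS_ge k).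
have {}IH := ler_wpM2l s_ge0 IH.
have upper := ler_wpM2l (mulr_ge0 q_ge0 (ler0n R k.+1)) (fact_elemsym_le k).
move: recur IH upper (congr1 (fun t => q * t) (binM_expr k)).
rewrite -/s -/q !subSS subn0 (binS k.+1 1) bin1 natrD (factS k.+1) (factS k).
rewrite !natrM !exprS; lra.
Qed.

Lemma exchange_sum_setD j k (F : {set I} -> {set I} -> R) :
  \sum_(E : {set I} | #|E| == (j + k)%N)
     \sum_(D : {set I} | (D \subset E) && (#|D| == j)) F D (E :\: D) =
  \sum_(D : {set I} | #|D| == j)
     \sum_(D' : {set I} | (#|D'| == k) && [disjoint D & D']) F D D'.
Proof.
rewrite (exchange_big_dep (fun D : {set I} => #|D| == j)) /=; last first.
  by move=> E D _ /andP[].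
apply: eq_bigr => D /eqP cD.
rewrite (reindex_onto (fun D' => D :|: D') (fun E => E :\: D)) /=; last first.
  by move=> E /andP[_ /andP[DE _]]; rewrite -{1}(setIidPr DE) setID.
have setUDK D' : ((D :|: D') :\: D == D') = [disjoint D & D'].
  by rewrite setDUl setDv set0U disjoint_sym; apply/eqP/setDidPl.
apply: eq_big => [D'|D' /andP[_ /eqP -> //]].
rewrite setUDK subsetUl cD eqxx andbT /= -andbA andTb.
case: (boolP [disjoint D & D']) => dis; last by rewrite !andbF.
by rewrite cardsU disjoint_setI0 // cards0 subn0 cD eqn_add2l.
Qed.

(* Splitting a (j+k)-set at random into a j-set and a k-set, either one of the
   parts satisfies B or the whole set does. *)
Lemma elemsymD_le B j k :
  (forall D E, [disjoint D & E] -> ~~ B D -> ~~ B E -> B (D :|: E)) ->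
  'C(j + k, j)%:R * elemsym (j + k) <=
  'C(j + k, j)%:R * elemsym_on B (j + k)
    + (elemsym_on B j * elemsym k + elemsym j * elemsym_on B k).
Proof.
move=> B_dichotomy; pose b D : R := (B D)%:R.
have elemsym_onE m :
    elemsym_on B m = \sum_(D : {set I} | #|D| == m) b D * setweight D.
  rewrite /elemsym_on big_mkcondr; apply: eq_bigr => D _; rewrite /b.
  by case: (B D); rewrite ?mul1r ?mul0r.
have sum_draws (G : {set I} -> R) :
    'C(j + k, j)%:R * \sum_(E : {set I} | #|E| == (j + k)%N) G E =
    \sum_(E : {set I} | #|E| == (j + k)%N)
      \sum_(D : {set I} | (D \subset E) && (#|D| == j)) G E.
  rewrite big_distrr /=; apply: eq_bigr => E /eqP cE.
  rewrite -cE -cards_draws mulr_natl -sumr_const.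
  by apply: eq_bigl => D; rewrite inE.
have pairs_le : \sum_(E : {set I} | #|E| == (j + k)%N)
      \sum_(D : {set I} | (D \subset E) && (#|D| == j))
        (b D + b (E :\: D)) * (setweight D * setweight (E :\: D)) <=
    elemsym_on B j * elemsym k + elemsym j * elemsym_on B k.
  rewrite (exchange_sum_setD j k
    (fun D D' => (b D + b D') * (setweight D * setweight D'))).
  rewrite !elemsym_onE !big_distrl -big_split /=; apply: ler_sum => D _.
  rewrite !big_distrr -big_split /=.
  rewrite [leRHS](bigID (fun D' => [disjoint D & D'])) /=.
  apply: ler_wpDr; first apply: sumr_ge0 => D' _.
    by rewrite addr_ge0 // ?mulr_ge0 ?setweight_ge0 ?ler0n.
  by apply: ler_sum => D' _; lra.
apply: le_trans (lerD (lexx _) pairs_le).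
rewrite elemsym_onE !sum_draws -big_split /=; apply: ler_sum => E _.
rewrite -big_split /=; apply: ler_sum => D /andP[DE _].
rewrite -setweight_setID // -mulrDl -[leLHS]mul1r ler_wpM2r ?setweight_ge0 //.
have dis : [disjoint D & E :\: D].
  by rewrite disjoint_sym disjoints_subset subsetDr.
have := B_dichotomy _ _ dis; rewrite -{3}(setIidPr DE) setID -!natrD ler1n.
by case: (B E); case: (B D); case: (B _) => // /(_ isT isT).
Qed.

End ElementarySymmetric.

Section ElementarySymmetricExp.
Variables (R : realType) (I : finType) (y : I -> R).
Hypothesis y_ge0 : forall i, 0 <= y i.

Lemma elemsym_le_exp_coeff k : elemsym y k <= exp_coeff (\sum_i y i) k.
Proof.
by rewrite /exp_coeff /= ler_pdivlMr ?ltr0n ?fact_gt0 // mulrC fact_elemsym_le.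
Qed.

Lemma elemsym_ge_exp_coeff (delta : R) k : 0 <= delta ->
  k%:R ^+ 2 * \sum_i y i ^+ 2 <= 2 * delta * (\sum_i y i) ^+ 2 ->
  (1 - delta) * exp_coeff (\sum_i y i) k <= elemsym y k.
Proof.
set s := \sum_i y i; set q := \sum_i y i ^+ 2 => delta_ge0 kq.
have s_ge0 : 0 <= s by exact: sumr_ge0.
have q_ge0 : 0 <= q by apply: sumr_ge0 => i _; exact: exprn_ge0.
rewrite /exp_coeff /= mulrA ler_pdivrMr ?ltr0n ?fact_gt0 // [leRHS]mulrC.
apply: le_trans (fact_elemsym_ge y_ge0 k); rewrite -/s -/q.
rewrite mulrBl mul1r lerD2l lerN2.
have [k2|k2] := ltnP k 2.
  by rewrite bin_small // !mul0r mulr_ge0 ?exprn_ge0.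
have -> : s ^+ k = s ^+ 2 * s ^+ (k - 2) by rewrite -exprD subnKC.
rewrite mulrA ler_wpM2r ?exprn_ge0 //.
have bin_le : 2 * 'C(k, 2)%:R <= k%:R ^+ 2 :> R.
  rewrite -natrM -natrX ler_nat mulnC (bin_ffact k 2) ffactnS ffactn1.
  by rewrite -mulnn leq_mul2l leq_pred orbT.
have := ler_wpM2r q_ge0 bin_le; lra.
Qed.

End ElementarySymmetricExp.

(** * Estimates for the exponential function *)

Section ExponentialEstimates.
Variable R : realType.
Implicit Types x r lam : R.

Lemma bin_exp_coeff x j k :
  'C(j + k, j)%:R * exp_coeff x (j + k) = exp_coeff x j * exp_coeff x k.
Proof.
rewrite /exp_coeff /= -(bin_fact (leq_addr k j)) addKn !natrM exprD; field.
by rewrite !pnatr_eq0 -!lt0n !fact_gt0 bin_gt0 leq_addr.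
Qed.

Lemma expR_le_pade x : 0 <= x -> x < 2 -> expR x <= (2 + x) / (2 - x).
Proof.
move=> x_ge0 x_lt2.
have partial_sum_le N :
    (2 - x) * series (exp_coeff x) N.+2 <= 2 + x - x * exp_coeff x N.+1.
  elim: N => [|N IH].
    rewrite /series /= !big_nat_recr //= big_geq // /exp_coeff /= !factS fact0.
    by rewrite expr0 expr1 !muln1 divr1; lra.
  rewrite seriesSr mulrDr.
  have coeffS : N.+2%:R * exp_coeff x N.+2 = x * exp_coeff x N.+1.
    rewrite /exp_coeff /= factS natrM exprS; field.
    by rewrite pnatr_eq0 -lt0n fact_gt0 -natrD pnatr_eq0.
  have : 2 * exp_coeff x N.+2 <= N.+2%:R * exp_coeff x N.+2.
    by rewrite ler_wpM2r ?exp_coeff_ge0 // ler_nat.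
  lra.
apply: limr_le; first exact: is_cvg_series_exp_coeff.
exists 2%N => // -[|[|N]] // _ /=.
rewrite ler_pdivlMr ?subr_gt0 // mulrC (le_trans (partial_sum_le N)) //.
by rewrite gerBl mulr_ge0 ?exp_coeff_ge0.
Qed.

Lemma expR1_ge2 : 2 <= expR 1 :> R.
Proof. by have := expR_ge1Dx (1 : R); lra. Qed.

Lemma expR1_le : expR 1 <= 14 / 5 :> R.
Proof.
have half : expR 2^-1 <= 5 / 3 :> R.
  by apply: le_trans (expR_le_pade _ _) _; rewrite ?ler_pdivrMr; lra.
rewrite -[1](@divff R 2) // expRM_natl.
by rewrite (le_trans (lerXn2r 2 _ _ half)) ?nnegrE ?expR_ge0 //; lra.
Qed.

Lemma expR1_lt_ln20 : expR 1 < ln 20 :> R.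
Proof.
rewrite -ltr_expR lnK ?posrE //.
have : expR (7 / 10) <= 27 / 13 :> R.
  by apply: le_trans (expR_le_pade _ _) _; rewrite ?ler_pdivrMr; lra.
move=> /(lerXn2r 4); rewrite !nnegrE expR_ge0 => /(_ isT) pow4.
apply: le_lt_trans (_ : expR (4%:R * (7 / 10)) < _).
  by rewrite ler_expR; have := expR1_le; lra.
by rewrite expRM_natl (le_lt_trans (pow4 _)) //; lra.
Qed.

Lemma iterated_ln_ge20 x : 20 <= x ->
  [/\ 2 <= ln x, 1 < ln (ln x) & ln (ln (ln 20)) <= ln (ln (ln x))].
Proof.
move=> x_ge20; have e_gt0 := expR_gt0 (1 : R).
have ln20_gt := expR1_lt_ln20.
have lnln20_gt1 : 1 < ln (ln 20) :> R.
  by rewrite -ltr_expR lnK // posrE (lt_trans e_gt0).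
have ln_le : ln 20 <= ln x by rewrite ler_ln ?posrE //; lra.
have lnln_le : ln (ln 20) <= ln (ln x) by rewrite ler_ln ?posrE //; lra.
by split; [have := expR1_ge2; lra | lra | rewrite ler_ln ?posrE //; lra].
Qed.

Lemma ln_natr_prod (I : Type) (s : seq I) (P : pred I) (F : I -> nat) :
  (forall i, P i -> (0 < F i)%N) ->
  ln (\prod_(i <- s | P i) F i)%:R = \sum_(i <- s | P i) ln (F i)%:R :> R.
Proof.
move=> F_gt0; apply: expR_inj; rewrite expR_sum natr_prod lnK.
  by apply: eq_bigr => i /F_gt0 Fi_gt0; rewrite lnK // posrE ltr0n.
by rewrite posrE prodr_gt0 // => i /F_gt0; rewrite ltr0n.
Qed.

Lemma sum_ln_natr_le (I : Type) (s : seq I) (P : pred I) (F : I -> nat) m n :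
  (0 < m)%N -> (forall i, P i -> (0 < F i)%N) ->
  (\prod_(i <- s | P i) F i <= m ^ n)%N ->
  \sum_(i <- s | P i) ln (F i)%:R <= n%:R * ln m%:R :> R.
Proof.
move=> m_gt0 F_gt0 prod_le; rewrite -ln_natr_prod // mulr_natl -lnXn ?ltr0n //.
rewrite -natrX ler_ln ?ler_nat // posrE ltr0n ?prodn_cond_gt0 //.
by rewrite expn_gt0 m_gt0.
Qed.

Lemma ln_ge1BV x : 0 < x -> 1 - x^-1 <= ln x.
Proof.
move=> x_gt0; have := @le_ln1Dx R (x^-1 - 1).
rewrite (addrC 1) subrK lnV ?posrE // lerNl opprB; apply.
by rewrite ltrBrDr addNr invr_gt0.
Qed.

Lemma ln_le_divr_expR1 x : 0 < x -> ln x <= x / expR 1.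
Proof.
move=> x_gt0; have := @ln_ge1BV (expR 1 / x).
rewrite divr_gt0 ?expR_gt0 // invf_div ln_div ?posrE ?expR_gt0 // expRK.
by move=> /(_ isT); lra.
Qed.

Lemma ln_fact_le_stirling k : (0 < k)%N ->
  ln (k`!%:R : R) <= 1 + (k%:R + 2^-1) * ln k%:R - k%:R.
Proof.
case: k => // k _; elim: k => [|k IH].
  by rewrite factS fact0 ln1 mulr0 addr0 subrr.
have k_gt0 : (0 : R) < k.+1%:R by rewrite ltr0n.
have kE : k.+2%:R = k.+1%:R + 1 :> R by rewrite -natr1.
have x_gt0 : 0 < k.+1%:R + 2^-1 :> R by lra.
have ln_ratio_ge : 1 <= (k.+1%:R + 2^-1) * (ln k.+2%:R - ln k.+1%:R) :> R.
  rewrite -ler_pdivrMl // mulr1.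
  have -> : ln k.+2%:R - ln k.+1%:R = ln (k.+2%:R / k.+1%:R) :> R.
    by rewrite ln_div ?posrE.
  rewrite -ler_expR lnK ?posrE ?divr_gt0 //.
  have x_lt2 : (k.+1%:R + 2^-1)^-1 < 2 :> R by rewrite invf_plt ?posrE; lra.
  apply: le_trans (expR_le_pade _ x_lt2) _; first by rewrite invr_ge0 ltW.
  rewrite kE; move: k.+1%:R k_gt0 => K K_gt0.
  rewrite [leLHS](_ : _ = (K + 1) / K) //.
  by field; rewrite !gt_eqF //; lra.
rewrite factS natrM lnM ?posrE ?ltr0n ?fact_gt0 //.
by move: IH ln_ratio_ge; rewrite kE; lra.
Qed.

Lemma exp_coeff_ge lam r k : 0 <= r -> 0 <= lam -> r * k%:R <= expR 1 * lam ->
  r ^+ k / (expR 1 * Num.sqrt k.+1%:R) <= exp_coeff lam k.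
Proof.
move=> r_ge0 lam_ge0 rk; have e_gt0 := expR_gt0 (1 : R).
have sqrt_gt0 m : 0 < Num.sqrt m.+1%:R :> R by rewrite sqrtr_gt0 ltr0n.
rewrite /exp_coeff /= ler_pdivrMr ?mulr_gt0 // mulrAC.
rewrite ler_pdivlMr ?ltr0n ?fact_gt0 //.
case: k rk => [|k] rk.
  by rewrite !expr0 sqrtr1 fact0 !mul1r mulr1; have := expR1_ge2; lra.
have k_gt0 : (0 : R) < k.+1%:R by rewrite ltr0n.
have fact_le : k.+1`!%:R <=
    expR 1 * Num.sqrt k.+1%:R * (k.+1%:R / expR 1) ^+ k.+1 :> R.
  rewrite -ler_ln ?posrE ?mulr_gt0 ?exprn_gt0 ?divr_gt0 ?ltr0n ?fact_gt0 //.
  rewrite !lnM ?posrE ?exprn_gt0 ?mulr_gt0 ?divr_gt0 ?invr_gt0 //.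
  rewrite lnXn ?divr_gt0 // -powR12_sqrt // ln_powR ln_div ?posrE // expRK.
  rewrite mulrnBl -(mulr_natl (ln _)).
  by have := ln_fact_le_stirling (ltn0Sn k); lra.
apply: le_trans (ler_wpM2l (exprn_ge0 _ r_ge0) fact_le) _.
rewrite mulrCA -exprMn [leRHS]mulrC.
have base_le : r * (k.+1%:R / expR 1) <= lam.
  by rewrite mulrA ler_pdivrMr // [leRHS]mulrC.
have base_ge0 : 0 <= r * (k.+1%:R / expR 1).
  by rewrite mulr_ge0 // divr_ge0 ?ltW.
apply: ler_pM; [by rewrite ltW ?mulr_gt0|exact: exprn_ge0| |exact: lerXn2r].
by rewrite ler_pM2l // ler_wsqrtr // ler_nat.
Qed.

End ExponentialEstimates.

(** * Sums over primes *)

Lemma binS_le_exp2 n k : ('C(n.+1, k) <= 2 ^ n)%N.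
Proof.
elim: n k => [|n IH] [|k] //.
- by case: k => [|k]; rewrite ?binn // bin_small.
- by rewrite bin0 expn_gt0.
- by rewrite binS expnS mul2n -addnn leq_add.
Qed.

Lemma bin_half_le n : ('C(n, n./2) <= 4 ^ n./2)%N.
Proof.
case: n => // n; apply: leq_trans (binS_le_exp2 _ _) _.
by rewrite -[4%N]/(2 ^ 2)%N -expnM leq_exp2l //; lia.
Qed.

Lemma pairwise_coprime_prime_powers (s : seq nat) (e : nat -> nat) :
  uniq s -> all prime s -> pairwise coprime [seq p ^ e p | p <- s]%N.
Proof.
elim: s => //= p s IH /andP[ps us] /andP[pp prs]; rewrite IH // andbT.
apply/allP => _ /mapP[q qs ->]; apply/coprimeXl/coprimeXr.
rewrite prime_coprime // dvdn_prime2 ?(allP prs _ qs) //.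
by apply: contraNneq ps => ->.
Qed.

Lemma prod_primes_dvd (s : seq nat) (m : nat) : uniq s -> all prime s ->
  (forall p, p \in s -> p %| m)%N -> (\prod_(p <- s) p %| m)%N.
Proof.
move=> us prs dvd_m; apply/Gauss_dvd_prod => [|p /dvd_m //].
by rewrite filter_predT (pairwise_coprime_prime_powers (fun=> 1%N)).
Qed.

Lemma prime_dvd_fact p m : prime p -> (p %| m`!)%N = (p <= m)%N.
Proof.
move=> pp; apply/idP/idP => [|pm]; last by rewrite dvdn_fact // prime_gt0.
elim: m => [|m IH]; first by rewrite fact0 Euclid_dvd1.
by rewrite factS Euclid_dvdM // => /orP[/dvdn_leq -> //|/IH]; exact: leqW.
Qed.

Lemma prime_dvd_bin n m p :
  prime p -> (m < p)%N -> (n - m < p)%N -> (p <= n)%N -> (p %| 'C(n, m))%N.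
Proof.
move=> pp mp nmp pn; have mn : (m <= n)%N by lia.
have := prime_dvd_fact n pp; rewrite pn -(bin_fact mn) !Euclid_dvdM //.
by rewrite !prime_dvd_fact // (leqNgt p m) mp (leqNgt p) nmp !orbF.
Qed.

Lemma primorial_le n : (\prod_(1 <= p < n.+1 | prime p) p <= 4 ^ n)%N.
Proof.
elim/ltn_ind: n => n IH; have [|n_gt1] := ltnP n 2.
  by case: n {IH} => [|[|]] // _; rewrite unlock.
have halves : n = (uphalf n + n./2)%N by lia.
rewrite (big_cat_nat _ _ (n := (uphalf n).+1)) //=; last by lia.
rewrite [in leqRHS]halves expnD leq_mul //; first by apply: IH; lia.
apply: leq_trans (bin_half_le n); rewrite -big_filter.
rewrite dvdn_leq ?bin_gt0 //; first by lia.
apply: prod_primes_dvd; first by rewrite filter_uniq // iota_uniq.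
  exact: filter_all.
move=> p; rewrite mem_filter mem_index_iota => /and3P[pp lt_p p_lt].
by apply: prime_dvd_bin => //; lia.
Qed.

Lemma mem_primes_prime n p : p \in primes n -> prime p.
Proof. by rewrite mem_primes => /and3P[]. Qed.

Lemma mem_primes_dvd n p : p \in primes n -> (p %| n)%N.
Proof. by rewrite mem_primes => /and3P[]. Qed.

Lemma ler_sum_uniq_subset (R : numDomainType) (T : eqType) (s t : seq T)
    (F : T -> R) :
  uniq s -> uniq t -> {subset s <= t} -> (forall i, i \in t -> 0 <= F i) ->
  \sum_(i <- s) F i <= \sum_(i <- t) F i.
Proof.
move=> us ut st F_ge0; rewrite [leRHS](bigID (mem s)) /=.
rewrite -[X in _ <= X + _]big_filter.
have perm_s : perm_eq [seq i <- t | i \in s] s.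
  apply: uniq_perm; rewrite ?filter_uniq // => i.
  by rewrite mem_filter andb_idr //; exact: st.
rewrite [X in _ <= X + _](perm_big s) //= lerDl big_seq_cond.
by apply: sumr_ge0 => i /andP[/F_ge0].
Qed.

Lemma ler_sum_mul_nonincreasing (R : numDomainType) (m n : nat)
    (a b w : nat -> R) :
  (forall i, (m <= i < n)%N -> 0 <= w i) ->
  (forall i, (m <= i)%N -> (i.+1 < n)%N -> w i.+1 <= w i) ->
  (forall k, (k <= n)%N -> \sum_(m <= i < k) a i <= \sum_(m <= i < k) b i) ->
  \sum_(m <= i < n) a i * w i <= \sum_(m <= i < n) b i * w i.
Proof.
move=> w_ge0 w_noninc ab; have [nm|mn] := leqP n m; first by rewrite !big_geq.
pose d i := b i - a i; rewrite -subr_ge0 -sumrB.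
have d_ge0 k : (k <= n)%N -> 0 <= \sum_(m <= i < k) d i.
  by move=> /ab; rewrite /d sumrB subr_ge0.
suff abel k : (m + k < n)%N ->
    (\sum_(m <= i < (m + k).+1) d i) * w (m + k)%N <=
    \sum_(m <= i < (m + k).+1) (b i * w i - a i * w i).
  have nE : n = (m + (n - m).-1).+1 by lia.
  have := abel (n - m).-1; rewrite -nE.
  move=> /(_ _)/(le_trans _); apply; last by lia.
  by rewrite mulr_ge0 ?d_ge0 ?w_ge0 //; lia.
elim: k => [|k IH] mk.
  by rewrite addn0 !big_nat1 /d mulrBl.
rewrite addnS big_nat_recr //= ?[leRHS]big_nat_recr //=; try lia.
rewrite mulrDl /d mulrBl lerD2r; apply: le_trans (IH _); last by lia.
by rewrite ler_wpM2l ?d_ge0 ?w_noninc //; lia.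
Qed.

Section PrimeSums.
Variable R : realType.

Lemma sum_divn_ln_prime_le n : (0 < n)%N ->
  \sum_(1 <= p < n.+1 | prime p) (n %/ p)%:R * ln p%:R <= n%:R * ln n%:R :> R.
Proof.
move=> n_gt0.
have fact_le : (n`! <= n ^ n)%N.
  rewrite fact_prod -[X in (_ <= _ ^ X)%N](subn1 n.+1) -prod_nat_const_nat.
  rewrite big_nat_cond [leqRHS]big_nat_cond; apply: leq_prod => i.
  by rewrite andbT ltnS => /andP[].
have prod_le : (\prod_(1 <= p < n.+1 | prime p) p ^ (n %/ p) <= n ^ n)%N.
  apply: leq_trans fact_le; rewrite -big_filter dvdn_leq ?fact_gt0 //.
  apply/Gauss_dvd_prod => [|p]; rewrite ?filter_predT.
    apply: pairwise_coprime_prime_powers; last exact: filter_all.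
    by rewrite filter_uniq ?iota_uniq.
  rewrite mem_filter => /andP[pp _] _.
  by rewrite pfactor_dvdn ?fact_gt0 // logn_fact // big_ltn // expn1 leq_addr.
rewrite (eq_bigr (fun p => ln (p ^ (n %/ p))%:R)) => [|p pp]; last first.
  by rewrite natrX lnXn ?ltr0n ?prime_gt0 // mulr_natl.
by apply: sum_ln_natr_le => // p pp; rewrite expn_gt0 prime_gt0.
Qed.

Lemma chebyshev_theta_le n :
  \sum_(1 <= p < n.+1 | prime p) ln p%:R <= n%:R * ln 4 :> R.
Proof. by apply: sum_ln_natr_le (primorial_le n) => // p; exact: prime_gt0. Qed.

Lemma mertens_first_le n : (0 < n)%N ->
  \sum_(1 <= p < n.+1 | prime p) ln p%:R / p%:R <= ln n%:R + ln 4 :> R.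
Proof.
move=> n_gt0; have n_gt0' : (0 : R) < n%:R by rewrite ltr0n.
rewrite -(ler_pM2l n_gt0') mulrDr.
apply: le_trans (lerD (sum_divn_ln_prime_le n_gt0) (chebyshev_theta_le n)).
rewrite -big_split /= big_distrr /=; apply: ler_sum => p pp.
have p_gt0 : (0 < p)%N := prime_gt0 pp.
have ln_p_ge0 : 0 <= ln p%:R :> R by rewrite ln_ge0 // ler1n.
rewrite -[X in _ <= _ + X]mul1r -mulrDl mulrA mulrAC ler_wpM2r //.
by rewrite ler_pdivrMr ?ltr0n // natr1 -natrM ler_nat ltnW // ltn_ceil.
Qed.

Lemma sum_ln_ratio_le n : (2 <= n)%N ->
  \sum_(3 <= i < n.+1) (ln i%:R - ln i.-1%:R) / ln i%:R <=
  ln (ln n%:R) - ln (ln 2) :> R.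
Proof.
move=> n_ge2; rewrite big_add1 -(telescope_sumr (fun i => ln (ln i%:R))) //.
rewrite [leLHS]big_nat [leRHS]big_nat; apply: ler_sum => i /andP[i_ge2 _].
have ln_i_gt0 : 0 < ln i%:R :> R by rewrite ln_gt0 // ltr1n.
have ln_iS_gt0 : 0 < ln i.+1%:R :> R by rewrite ln_gt0 // ltr1n ltnW.
rewrite mulrBl divff ?gt_eqF //= -ln_div ?posrE //.
by rewrite -[ln i%:R / _]invf_div ln_ge1BV // divr_gt0.
Qed.

Lemma mertens_second_le n : (2 <= n)%N ->
  \sum_(1 <= p < n.+1 | prime p) p%:R^-1 <=
  ln (ln n%:R) + (1 - ln (ln 2) + ln 4 / ln 2) :> R.
Proof.
move=> n_ge2; have ln2_gt0 : 0 < ln 2 :> R by rewrite ln_gt0 // ltr1n.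
pose log_term p : R := if prime p then ln p%:R / p%:R else 0.
pose increment p : R := if p == 2 then ln 2 + ln 4 else ln p%:R - ln p.-1%:R.
have sum_log_term k : \sum_(2 <= p < k.+1) log_term p =
    \sum_(1 <= p < k.+1 | prime p) ln p%:R / p%:R.
  rewrite -big_mkcond /=; case: k => [|k]; first by rewrite !big_geq.
  by rewrite [RHS]big_ltn_cond.
have sum_increment k : (2 <= k)%N ->
    \sum_(2 <= p < k.+1) increment p = ln k%:R + ln 4.
  move=> k_ge2; rewrite big_ltn // {1}/increment eqxx big_add1.
  rewrite (eq_big_nat _ _ (F2 := fun i => ln i.+1%:R - ln i%:R)) => [|i].
    by rewrite (telescope_sumr (fun i => ln i%:R)) //; ring.
  by rewrite /increment => /andP[i_ge2 _]; case: eqP => //; lia.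
have ln_i_gt0 i : (2 <= i)%N -> 0 < ln i%:R :> R.
  by move=> ?; rewrite ln_gt0 // ltr1n.
have -> : \sum_(1 <= p < n.+1 | prime p) p%:R^-1 =
    \sum_(2 <= p < n.+1) log_term p * (ln p%:R)^-1.
  rewrite big_ltn_cond ?ltnS 1?ltnW //= big_mkcond.
  apply: eq_big_nat => p /andP[p_ge2 _]; rewrite /log_term; case: ifP => _.
    by rewrite mulrAC divff ?mul1r // gt_eqF ?ln_i_gt0.
  by rewrite mul0r.
apply: le_trans (ler_sum_mul_nonincreasing (b := increment) _ _ _) _.
- by move=> i /andP[i_ge2 _]; rewrite invr_ge0 ltW ?ln_i_gt0.
- move=> i i_ge2 _; rewrite lef_pV2 ?posrE ?ln_i_gt0 ?(leqW i_ge2) //.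
  by rewrite ler_ln ?posrE ?ltr0n ?ler_nat //; lia.
- move=> [|k] _; first by rewrite !big_geq.
  have [k_lt2|k_ge2] := ltnP k 2; first by rewrite !big_geq //; lia.
  by rewrite sum_log_term sum_increment // mertens_first_le //; lia.
rewrite big_ltn // {1}/increment eqxx mulrDl divff ?gt_eqF //.
have := sum_ln_ratio_le n_ge2.
rewrite (eq_big_nat _ _ (F2 := fun i => increment i / ln i%:R)) => [|i].
  by lra.
by rewrite /increment => /andP[i_ge3 _]; case: eqP => //; lia.
Qed.

Definition sum_inv_primes n : R := \sum_(p <- primes n) p%:R^-1.

Lemma sum_inv_primes_ge0 n : 0 <= sum_inv_primes n.
Proof. by apply: sumr_ge0 => p _; rewrite invr_ge0 ler0n. Qed.

Lemma size_primes_le n : (0 < n)%N ->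
  (size (primes n))%:R * ln 2 <= ln n%:R :> R.
Proof.
move=> n_gt0.
rewrite mulr_natl -lnXn ?ltr0n // ler_ln ?posrE ?exprn_gt0 ?ltr0n //.
rewrite -natrX ler_nat; apply: (@leq_trans (\prod_(p <- primes n) p)%N).
  rewrite -(count_predT (primes n)) -iter_muln_1 -big_const_seq.
  rewrite big_seq [leqRHS]big_seq; apply: leq_prod => p.
  by move/mem_primes_prime/prime_gt1.
rewrite dvdn_leq // prod_primes_dvd ?primes_uniq //; last exact: mem_primes_dvd.
by apply/allP => p; exact: mem_primes_prime.
Qed.

Definition mertens_const : R := 1 - ln (ln 2) + ln 4 / ln 2 + (ln 2)^-1.

(* The prime divisors up to log n are bounded by Mertens' theorem; there are at
   most log n / log 2 larger ones. *)
Lemma sum_inv_primes_le n : 2 <= ln n%:R :> R ->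
  sum_inv_primes n <= ln (ln (ln n%:R)) + mertens_const.
Proof.
move=> ln_n_ge2; have ln_n_gt0 : 0 < ln n%:R :> R by lra.
have n_gt0 : (0 < n)%N.
  by rewrite lt0n; apply: contraTneq ln_n_gt0 => ->; rewrite ln0 ?ltxx.
have ln2_gt0 : 0 < ln 2 :> R by rewrite ln_gt0 // ltr1n.
pose N := Num.truncn (ln n%:R : R).
have N_ge2 : (2 <= N)%N by rewrite truncn_ge_nat // ltW.
have /andP[N_le lt_N] := truncn_itv (ltW ln_n_gt0); rewrite -/N in N_le lt_N.
have small_le : \sum_(p <- primes n | (p <= N)%N) p%:R^-1 <=
    ln (ln (ln n%:R)) + (1 - ln (ln 2) + ln 4 / ln 2) :> R.
  apply: (@le_trans _ _ (\sum_(1 <= p < N.+1 | prime p) p%:R^-1)).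
    rewrite -big_filter -[leRHS]big_filter; apply: ler_sum_uniq_subset.
    - by rewrite filter_uniq // primes_uniq.
    - by rewrite filter_uniq // iota_uniq.
    - move=> p; rewrite !mem_filter mem_index_iota ltnS => /andP[-> pn].
      by rewrite (mem_primes_prime pn) prime_gt0 ?(mem_primes_prime pn).
    - by move=> p _; rewrite invr_ge0 ler0n.
  apply: le_trans (mertens_second_le N_ge2) _; rewrite lerD2r.
  have ln_N_gt0 : 0 < ln N%:R :> R by rewrite ln_gt0 // ltr1n.
  have ln_N_le : ln N%:R <= ln (ln n%:R) :> R.
    by rewrite ler_ln ?posrE // ltr0n ltnW.
  by rewrite ler_ln ?posrE //; exact: lt_le_trans ln_N_le.
have large_le : \sum_(p <- primes n | ~~ (p <= N)%N) p%:R^-1 <= (ln 2)^-1 :> R.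
  apply: (@le_trans _ _ (\sum_(p <- primes n) (ln n%:R)^-1)).
    rewrite [leLHS]big_mkcond; apply: ler_sum => p _.
    case: ifP => [|_]; last by rewrite invr_ge0 ltW.
    rewrite -ltnNge => N_lt; rewrite lef_pV2 ?posrE // ?ltr0n; last by lia.
    by apply: le_trans (ltW lt_N) _; rewrite ler_nat.
  rewrite big_const_seq count_predT iter_addr_0 -[leLHS]mulr_natl.
  by rewrite ler_pdivrMr // mulrC ler_pdivlMr // size_primes_le.
by rewrite /sum_inv_primes (bigID (fun p => p <= N)%N) /mertens_const /=; lra.
Qed.

Lemma sum_inv_primes_mul_pred_le1 n :
  \sum_(p <- primes n) (p%:R * (p%:R - 1))^-1 <= 1 :> R.
Proof.
apply: (@le_trans _ _ (\sum_(2 <= p < n.+2) (p%:R * (p%:R - 1))^-1)).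
  apply: ler_sum_uniq_subset; rewrite ?primes_uniq ?iota_uniq //.
    move=> p; rewrite mem_primes mem_index_iota => /and3P[pp n_gt0 pn].
    by rewrite prime_gt1 //= ltnS leqW // dvdn_leq.
  move=> p; rewrite mem_index_iota => /andP[p_ge2 _].
  by rewrite invr_ge0 mulr_ge0 // subr_ge0 ler1n ltnW.
have -> : \sum_(2 <= p < n.+2) (p%:R * (p%:R - 1))^-1 = 1 - n.+1%:R^-1 :> R.
  elim: n => [|n IH]; first by rewrite big_geq // invr1 subrr.
  rewrite big_nat_recr //= IH -[n.+2%:R]natr1.
  have n_gt0 : (0 : R) < n.+1%:R by rewrite ltr0n.
  by field; rewrite !gt_eqF //; lra.
by rewrite gerBl invr_ge0.
Qed.

Lemma totient_ge n : (0 < n)%N ->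
  n%:R * expR (- sum_inv_primes n - 1) <= (totient n)%:R :> R.
Proof.
move=> n_gt0.
apply: (@le_trans _ _ (n%:R * \prod_(p <- primes n) expR (- (p%:R - 1)^-1))).
  rewrite ler_wpM2l // -expR_sum ler_expR sumrN -opprD lerN2.
  have -> : \sum_(p <- primes n) (p%:R - 1)^-1 =
      sum_inv_primes n + \sum_(p <- primes n) (p%:R * (p%:R - 1))^-1.
    rewrite -big_split /=; apply: eq_big_seq => p /mem_primes_prime/prime_gt1.
    by rewrite -(ltr1n R) => p_gt1; field; rewrite !gt_eqF //; lra.
  by rewrite lerD2l sum_inv_primes_mul_pred_le1.
have {1}-> : n%:R = \prod_(p <- primes n) (p ^ logn p n)%:R :> R.
  by rewrite -natr_prod {1}(prod_prime_decomp n_gt0) prime_decompE big_map.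
rewrite totientE // natr_prod -big_split /= big_seq [leRHS]big_seq.
apply: ler_prod => p pn; rewrite mulr_ge0 ?expR_ge0 ?ler0n //=.
have p_gt1 : (1 < p)%N := prime_gt1 (mem_primes_prime pn).
have p_gt1' : (1 : R) < p%:R by rewrite ltr1n.
have log_gt0 : (0 < logn p n)%N by rewrite logn_gt0.
rewrite -{1}(prednK log_gt0) expnS !natrM mulrAC ler_wpM2r ?ler0n //.
rewrite -subn1 natrB ?(ltnW p_gt1) // expRN ler_pdivrMr ?expR_gt0 //.
have pred_gt0 : 0 < p%:R - 1 :> R by rewrite subr_gt0.
apply: le_trans (ler_wpM2l (ltW pred_gt0) (expR_ge1Dx _)).
by rewrite mulrDr mulr1 divff ?subrK // gt_eqF.
Qed.

End PrimeSums.

(** * Product-free sets *)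

Lemma eqn_modMl_gcdn n a u v : (0 < n)%N ->
  (a * u == a * v %[mod n])%N = (u == v %[mod n %/ gcdn n a])%N.
Proof.
move=> n_gt0; wlog vu : u v / (v <= u)%N => [wlog_le|].
  by have [/wlog_le //|/ltnW/wlog_le uv] := leqP v u; rewrite eq_sym uv eq_sym.
have g_gt0 : (0 < gcdn n a)%N by rewrite gcdn_gt0 n_gt0.
have cop : coprime (n %/ gcdn n a) (a %/ gcdn n a).
  rewrite /coprime -(eqn_pmul2r g_gt0) muln_gcdl mul1n.
  by rewrite !divnK ?dvdn_gcdl ?dvdn_gcdr.
rewrite !eqn_mod_dvd ?leq_mul2l ?vu ?orbT // -mulnBr -(Gauss_dvdr _ cop).
by rewrite -[RHS](dvdn_pmul2r g_gt0) mulnAC !divnK ?dvdn_gcdl ?dvdn_gcdr.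
Qed.

Lemma sum_card_fibers_le (J T : finType) (V : eqType) (A : {set T})
    (P : pred J) (f : T -> V) (g : J -> V) : {in P &, injective g} ->
  (\sum_(j | P j) #|[set x in A | f x == g j]| <= #|A|)%N.
Proof.
move=> g_inj.
have -> : (\sum_(j | P j) #|[set x in A | f x == g j]| =
    \sum_(x in A) \sum_(j | P j) (f x == g j))%N.
  rewrite exchange_big /=; apply: eq_bigr => j _.
  rewrite -sum1_card big_mkcond [RHS]big_mkcond /=.
  by apply: eq_bigr => x _; rewrite !inE; case: (x \in A); case: eqP.
rewrite -sum1_card; apply: leq_sum => x _.
have [j /andP[Pj /eqP fx]|no_j] := pickP (fun j => P j && (f x == g j)).
  rewrite (bigD1 j) //= fx eqxx big1 // => i /andP[Pi ij].
  by apply/eqP; rewrite eqb0; apply: contra ij => /eqP/g_inj ->.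
by rewrite big1 // => j Pj; have := no_j j; rewrite Pj /= => ->.
Qed.

Section ProductFree.
Variables (n : nat) (S : {set 'I_n.+1}).

Definition residue_units : {set 'I_n.+1} := [set u : 'I_n.+1 | coprime n.+1 u].

Definition units_outside d : {set 'I_n.+1} :=
  [set u in residue_units | inZp (d * u) \notin S].

Definition sparse_at d : bool := (totient n.+1 <= 2 * #|units_outside d|)%N.

Lemma card_residue_units : #|residue_units| = totient n.+1.
Proof.
rewrite totient_count_coprime big_mkord -sum1_card big_mkcond /=.
by apply: eq_bigr => u _; rewrite inE; case: coprime.
Qed.

Lemma gcdn_inZpM d u : (d %| n.+1)%N -> coprime n.+1 u ->
  gcdn (inZp (d * u) : 'I_n.+1) n.+1 = d.
Proof.
move=> dn cu; rewrite /= gcdn_modl -{1}(divnK dn) (mulnC _ d) -muln_gcdr.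
rewrite gcdnC; have /eqP -> : coprime (n.+1 %/ d) u; last by rewrite muln1.
exact: coprime_dvdl (dvdn_div dn) cu.
Qed.

Lemma card_units_outside_le d : (d %| n.+1)%N ->
  (#|units_outside d| <= #|[set c in ~: S | gcdn c n.+1 == d]| * d)%N.
Proof.
move=> dn; have d_gt0 : (0 < d)%N := dvdn_gt0 (ltn0Sn n) dn.
have nd_gt0 : (0 < n.+1 %/ d)%N by rewrite divn_gt0 // dvdn_leq.
have quo_lt (u : 'I_n.+1) : (u %/ (n.+1 %/ d) < d)%N.
  by rewrite ltn_divLR // mulnC divnK.
pose f (u : 'I_n.+1) : 'I_n.+1 * 'I_d := (inZp (d * u), Ordinal (quo_lt u)).
have f_inj : injective f.
  move=> u v [/eqP]; rewrite eqn_modMl_gcdn // (gcdn_idPr dn).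
  move=> /eqP same_rem same_quo; apply/val_inj => /=.
  by rewrite (divn_eq u (n.+1 %/ d)) same_rem same_quo -divn_eq.
rewrite -(card_imset _ f_inj) -[d in (_ * d)%N]card_ord -cardsT -cardsX.
apply/subset_leq_card/subsetP => _ /imsetP[u + ->].
rewrite !inE => /andP[cu ->]; rewrite andbT /=.
by have /= -> := gcdn_inZpM dn cu; rewrite eqxx.
Qed.

(* Some d * u0 lies in S, and then d * u0 * (e * u) = d * e * (u0 * u) lies
   outside S whenever e * u lies in S. *)
Lemma sparse_atM d e : product_free S ->
  ~~ sparse_at d -> ~~ sparse_at e -> sparse_at (d * e).
Proof.
rewrite /sparse_at -!ltnNge => pfS d_dense e_dense.
have /subsetPn[u0] : ~~ (residue_units \subset units_outside d).
  by apply/negP => /subset_leq_card; rewrite card_residue_units; lia.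
move=> u0_unit; rewrite inE u0_unit /= negbK => d_u0.
have u0_coprime : coprime n.+1 u0 by rewrite inE in u0_unit.
pose mul_u0 (u : 'I_n.+1) : 'I_n.+1 := inZp (u0 * u).
have mul_inj : injective mul_u0.
  move=> u v [/eqP]; rewrite eqn_modMl_gcdn // (eqP u0_coprime) divn1 => /eqP.
  by rewrite !modn_small // => /val_inj.
have mul_sub : mul_u0 @: (residue_units :\: units_outside e)
    \subset units_outside (d * e).
  apply/subsetP => _ /imsetP[u + ->].
  rewrite !inE => /andP[+ cu]; rewrite cu /= negbK => e_u.
  rewrite coprime_modr coprimeMr u0_coprime cu; apply/negP => de_uu0.
  move/forall_inP: pfS => /(_ _ d_u0)/forall_inP/(_ _ e_u).
  move=> /forall_inP/(_ _ de_uu0)/negP; apply; apply/eqP.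
  rewrite /= modnMml modnMmr modn_mod modnMmr.
  by congr (_ %% _)%N; ring.
have : (totient n.+1 <= #|units_outside e| + #|units_outside (d * e)|)%N.
  rewrite -leq_subLR -card_residue_units.
  apply: leq_trans (subset_leq_card mul_sub).
  by rewrite card_imset // cardsD leq_sub2l // subset_leq_card ?subsetIr.
by move: e_dense; move: #|units_outside e| #|units_outside (d * e)| => x y; lia.
Qed.

Lemma sum_inv_sparse_le (R : realFieldType) (J : finType) (P : pred J)
    (d : J -> nat) :
  {in P &, injective d} ->
  (forall j, P j -> (d j %| n.+1)%N && sparse_at (d j)) ->
  (\sum_(j | P j) (d j)%:R^-1) * (totient n.+1)%:R <= 2 * #|~: S|%:R :> R.
Proof.
move=> d_inj d_sparse.
have fibers_le := sum_card_fibers_le (~: S) (fun c => gcdn c n.+1) d_inj.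
rewrite -(ler_nat R) in fibers_le.
apply: le_trans (ler_wpM2l (ler0n R 2) fibers_le).
rewrite natr_sum big_distrl big_distrr /=; apply: ler_sum => j Pj.
have /andP[dn sparse_d] := d_sparse j Pj.
rewrite mulrC ler_pdivrMr ?ltr0n ?(dvdn_gt0 _ dn) // -!natrM ler_nat.
by apply: leq_trans sparse_d _; rewrite -mulnA leq_mul2l card_units_outside_le.
Qed.

End ProductFree.

Section PrimeDivisors.
Variable n : nat.

Definition prime_divisor (i : 'I_(size (primes n))) : nat :=
  tnth (in_tuple (primes n)) i.

Definition inv_prime_divisor (R : realType) (i : 'I_(size (primes n))) : R :=
  (prime_divisor i)%:R^-1.

Definition prod_prime_divisors (D : {set 'I_(size (primes n))}) : nat :=
  \prod_(i in D) prime_divisor i.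

Lemma mem_prime_divisor i : prime_divisor i \in primes n.
Proof. exact: (mem_tnth i (in_tuple (primes n))). Qed.

Lemma prime_divisor_prime i : prime (prime_divisor i).
Proof. exact: mem_primes_prime (mem_prime_divisor i). Qed.

Lemma prime_divisor_inj : injective prime_divisor.
Proof. by apply/tuple_uniqP; exact: primes_uniq. Qed.

Lemma dvdn_prod_prime_divisors D : (prod_prime_divisors D %| n)%N.
Proof.
rewrite /prod_prime_divisors -big_enum /= -(big_map prime_divisor xpredT id).
apply: prod_primes_dvd.
- by rewrite map_inj_uniq ?enum_uniq //; exact: prime_divisor_inj.
- by apply/allP => _ /mapP[i _ ->]; exact: prime_divisor_prime.
- by move=> _ /mapP[i _ ->]; exact: mem_primes_dvd (mem_prime_divisor i).
Qed.

Lemma prod_prime_divisors_inj : injective prod_prime_divisors.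
Proof.
have memE (D : {set _}) i :
    (i \in D) = (prime_divisor i %| prod_prime_divisors D)%N.
  rewrite Euclid_dvd_prod ?prime_divisor_prime // big_has_cond.
  apply/idP/hasP => [iD|[j _ /andP[jD]]].
    by exists i; rewrite ?mem_index_enum //= iD dvdnn.
  by rewrite dvdn_prime2 ?prime_divisor_prime // => /eqP/prime_divisor_inj ->.
by move=> D E DE; apply/setP => i; rewrite !memE DE.
Qed.

Lemma setweight_inv_prime_divisor (R : realType) D :
  setweight (@inv_prime_divisor R) D = (prod_prime_divisors D)%:R^-1.
Proof. by rewrite /setweight natr_prod prodfV. Qed.

Lemma inv_prime_divisor_ge0 (R : realType) i : 0 <= inv_prime_divisor R i.
Proof. by rewrite invr_ge0 ler0n. Qed.

Lemma sum_inv_prime_divisor (R : realType) :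
  \sum_i inv_prime_divisor R i = sum_inv_primes R n.
Proof. by rewrite [RHS]big_tnth. Qed.

Lemma sum_inv_prime_divisor_sqr (R : realType) :
  \sum_i inv_prime_divisor R i ^+ 2 <= 1.
Proof.
apply: le_trans (sum_inv_primes_mul_pred_le1 R n).
rewrite [leRHS]big_tnth; apply: ler_sum => i _.
have := prime_gt1 (prime_divisor_prime i); rewrite -(ltr1n R) => p_gt1.
rewrite exprVn lef_pV2 ?posrE ?mulr_gt0 ?exprn_gt0 //; [|lra..].
by rewrite expr2 ler_pM2l; lra.
Qed.

End PrimeDivisors.

Section Complement.
Variables (R : realType) (n : nat) (S : {set 'I_n.+1}).
Hypothesis pfS : product_free S.
Let y := @inv_prime_divisor n.+1 R.
Let lam := sum_inv_primes R n.+1.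

Let y_ge0 i : 0 <= y i.
Proof. exact: inv_prime_divisor_ge0. Qed.

Lemma elemsym_totient_le j k :
  'C(j + k, j)%:R * elemsym y (j + k) * (totient n.+1)%:R <=
  2 * #|~: S|%:R * ('C(j + k, j)%:R + elemsym y j + elemsym y k).
Proof.
pose sparse D := sparse_at S (@prod_prime_divisors n.+1 D).
have sparse_dichotomy (D E : {set 'I_(size (primes n.+1))}) :
    [disjoint D & E] -> ~~ sparse D -> ~~ sparse E -> sparse (D :|: E).
  move=> DE; rewrite /sparse => D_dense E_dense.
  rewrite (_ : prod_prime_divisors _ =
    (prod_prime_divisors D * prod_prime_divisors E)%N); first exact: sparse_atM.
  by rewrite /prod_prime_divisors -bigU //; apply: eq_bigl => i; rewrite inE.
have on_sparse m : elemsym_on y sparse m * (totient n.+1)%:R <= 2 * #|~: S|%:R.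
  rewrite /elemsym_on.
  rewrite (eq_bigr (fun D => (prod_prime_divisors D)%:R^-1)) => [|D _].
    apply: sum_inv_sparse_le.
      by move=> D E _ _; exact: prod_prime_divisors_inj.
    by move=> D /andP[_ sparse_D]; apply/andP; rewrite dvdn_prod_prime_divisors.
  exact: setweight_inv_prime_divisor.
have totient_ge0 : 0 <= (totient n.+1)%:R :> R by rewrite ler0n.
have := ler_wpM2r totient_ge0 (elemsymD_le y_ge0 j k sparse_dichotomy).
have := ler_wpM2l (ler0n R 'C(j + k, j)) (on_sparse (j + k)%N).
have := ler_wpM2l (elemsym_ge0 y_ge0 k) (on_sparse j).
have := ler_wpM2l (elemsym_ge0 y_ge0 j) (on_sparse k).
lra.
Qed.

Lemma totient_le_complement (eps W : R) j k :
  0 <= eps -> 0 < W ->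
  eps * exp_coeff lam (j + k) <= elemsym y (j + k) ->
  W <= exp_coeff lam j -> W <= exp_coeff lam k -> W <= exp_coeff lam (j + k) ->
  eps * W * (totient n.+1)%:R <= 6 * #|~: S|%:R.
Proof.
move=> eps_ge0 W_gt0 lower.
have := elemsym_totient_le j k; have := bin_exp_coeff lam j k.
have e_le m : elemsym y m <= exp_coeff lam m.
  by rewrite /lam -sum_inv_prime_divisor elemsym_le_exp_coeff.
move: (e_le j) (e_le k) lower.
set a := exp_coeff lam j; set b := exp_coeff lam k; set c := exp_coeff lam _.
set C := 'C(_, _)%:R; set phi := (totient _)%:R; set X := #|_|%:R.
move=> ej_le ek_le lower Cc upper aW bW cW.
have X_ge0 : 0 <= 2 * X by rewrite mulr_ge0 ?ler0n.
have phi_ge0 : 0 <= phi by rewrite ler0n.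
have C_ge0 : 0 <= C by rewrite ler0n.
have [a_gt0 b_gt0 c_gt0] : [/\ 0 < a, 0 < b & 0 < c] by split; lra.
have phi_le : eps * phi <= 2 * X * (a^-1 + b^-1 + c^-1).
  have Cc_gt0 : 0 < C * c by rewrite Cc mulr_gt0.
  rewrite -(ler_pM2l Cc_gt0) [leRHS](_ : _ = 2 * X * (C + b + a)); last first.
    have -> : C = a * b / c by rewrite -Cc mulfK // gt_eqF.
    by field; rewrite !gt_eqF.
  have -> : C * c * (eps * phi) = C * (eps * c) * phi by ring.
  apply: le_trans (le_trans upper _); first by rewrite ler_wpM2r ?ler_wpM2l.
  by rewrite ler_wpM2l //; lra.
have W_div x : W <= x -> W * x^-1 <= 1.
  by move=> Wx; rewrite ler_pdivrMr ?mul1r //; lra.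
have := ler_wpM2l (ltW W_gt0) phi_le.
have := ler_wpM2l X_ge0 (lerD (lerD (W_div _ aW) (W_div _ bW)) (W_div _ cW)).
lra.
Qed.

End Complement.

(** * The maximal density *)

Section DensityBound.
Variable R : realType.

Definition density_exponent : R := 1 - 1 / 2 * expR 1 * ln 2.

Lemma density_exponent_ge0 : 0 <= density_exponent.
Proof.
have e_gt0 := expR_gt0 (1 : R).
have := @ln_le_divr_expR1 R 2 (ltr0n _ 2); rewrite ler_pdivlMr //.
by rewrite /density_exponent; lra.
Qed.

Definition decay (lam : R) : R :=
  expR (- (density_exponent * lam)) / Num.sqrt lam.

Lemma decay_gt0 lam : 0 < lam -> 0 < decay lam.
Proof. by move=> lam_gt0; rewrite divr_gt0 ?expR_gt0 ?sqrtr_gt0. Qed.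

Lemma ler_decay x y : 0 < x -> x <= y -> decay y <= decay x.
Proof.
move=> x_gt0 xy; apply: ler_pM; rewrite ?expR_ge0 ?invr_ge0 ?sqrtr_ge0 //.
  by rewrite ler_expR lerN2 ler_wpM2l ?density_exponent_ge0.
by rewrite lef_pV2 ?posrE ?sqrtr_gt0 ?ler_wsqrtr //; lra.
Qed.

Lemma decayD_ge a x y : 0 < a -> a <= x -> 0 <= y ->
  expR (- (density_exponent * y)) / Num.sqrt (1 + y / a) * decay x <=
  decay (x + y).
Proof.
move=> a_gt0 ax y_ge0; have ya_ge0 : 0 <= y / a by rewrite divr_ge0 // ltW.
have x_gt0 : 0 < x := lt_le_trans a_gt0 ax.
have -> : expR (- (density_exponent * y)) / Num.sqrt (1 + y / a) * decay x =
    expR (- (density_exponent * (x + y))) / Num.sqrt ((1 + y / a) * x).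
  rewrite sqrtrM ?addr_ge0 // mulrDr opprD expRD invfM /decay.
  by rewrite mulrACA [X in X * _]mulrC.
rewrite ler_wpM2l ?expR_ge0 // lef_pV2 ?posrE ?sqrtr_gt0 ?mulr_gt0 ?ltr_pwDl //.
by rewrite ler_wsqrtr // mulrDl mul1r lerD2l mulrAC ler_pdivlMr // ler_wpM2l.
Qed.

Definition exp_coeff_lbound (lam : R) : R :=
  expR (1 / 2 * expR 1 * ln 2 * lam) / (24 * Num.sqrt (lam + 1)).

Lemma exp_coeff_lbound_gt0 (lam : R) : 0 <= lam -> 0 < exp_coeff_lbound lam.
Proof.
move=> lam_ge0; rewrite divr_gt0 ?expR_gt0 // mulr_gt0 // sqrtr_gt0.
by rewrite ltr_wpDl.
Qed.

Lemma exp_coeff_lbound_le (lam : R) k : 0 <= lam ->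
  k%:R <= expR 1 / 4 * lam -> expR 1 / 4 * lam < k.+1%:R ->
  exp_coeff_lbound lam <= 4 ^+ k / (expR 1 * Num.sqrt (k + k).+1%:R).
Proof.
move=> lam_ge0 k_le lt_k; have e_gt0 := expR_gt0 (1 : R).
have e_le := expR1_le R; have e_lam_le := ler_wpM2r lam_ge0 e_le.
have ln2_gt0 : 0 < ln 2 :> R by rewrite ln_gt0 // ltr1n.
have expR_le : expR (1 / 2 * expR 1 * ln 2 * lam) <= 4 * 4 ^+ k.
  have -> : 4 * 4 ^+ k = expR (k.+1%:R * (2%:R * ln 2)) :> R.
    by rewrite !expRM_natl lnK ?posrE // -(natrX _ 2 2) -exprS.
  by rewrite ler_expR; have := ler_wpM2r (ltW ln2_gt0) (ltW lt_k); lra.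
have sqrt_le : Num.sqrt (k + k).+1%:R <= 2 * Num.sqrt (lam + 1).
  have -> : 2 = Num.sqrt (2 ^+ 2) :> R by rewrite sqrtr_sqr ger0_norm.
  by rewrite -sqrtrM ?exprn_ge0 // ler_wsqrtr // -natr1 natrD; lra.
have sqrt_gt0 : 0 < Num.sqrt (lam + 1) by rewrite sqrtr_gt0; lra.
have sqrtk_gt0 : 0 < Num.sqrt (k + k).+1%:R :> R by rewrite sqrtr_gt0 ltr0n.
have e_sqrt_le : expR 1 * Num.sqrt (k + k).+1%:R <= 6 * Num.sqrt (lam + 1).
  by have := ler_pM (ltW e_gt0) (ltW sqrtk_gt0) e_le sqrt_le; lra.
rewrite ler_pdivlMr ?mulr_gt0 // mulrAC ler_pdivrMr ?mulr_gt0 //.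
have e_sqrt_ge0 := mulr_ge0 (ltW e_gt0) (ltW sqrtk_gt0).
by have := ler_pM (expR_ge0 _) e_sqrt_ge0 expR_le e_sqrt_le; lra.
Qed.

Lemma exp_coeff_lboundE (lam : R) :
  24 * exp_coeff_lbound lam * expR (- lam - 1) =
  expR (density_exponent - 1) * decay (lam + 1).
Proof.
have -> : expR (density_exponent - 1) * decay (lam + 1) =
    expR (1 / 2 * expR 1 * ln 2 * lam) * expR (- lam - 1) / Num.sqrt (lam + 1).
  rewrite mulrA -!expRD /density_exponent; congr (expR _ / _); ring.
rewrite /exp_coeff_lbound invfM; move: (Num.sqrt _)^-1 => inv_sqrt.
by field.
Qed.

(* The ratio k / lam = e / 4 is the one for which lam^j / j! is of the same
   exponential order 4^k at j = k and at j = 2k. *)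
Lemma exp_coeff_double_ge (lam : R) : 0 <= lam -> exists k : nat,
  [/\ (k + k)%:R <= 7 / 5 * lam,
      exp_coeff_lbound lam <= exp_coeff lam k &
      exp_coeff_lbound lam <= exp_coeff lam (k + k)].
Proof.
move=> lam_ge0; have e_gt0 := expR_gt0 (1 : R).
have s_ge0 : 0 <= expR 1 / 4 * lam by rewrite mulr_ge0 // divr_ge0 ?ltW.
have [k /andP[k_le lt_k]] : exists k, k%:R <= expR 1 / 4 * lam < k.+1%:R.
  by exists (Num.truncn (expR 1 / 4 * lam)); exact: truncn_itv.
have lbound_le := exp_coeff_lbound_le lam_ge0 k_le lt_k.
exists k; split.
- by rewrite natrD; have := ler_wpM2r lam_ge0 (expR1_le R); lra.
- have coeff_ge : 4 ^+ k / (expR 1 * Num.sqrt k.+1%:R) <= exp_coeff lam k.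
    by apply: exp_coeff_ge => //; lra.
  apply: le_trans lbound_le (le_trans _ coeff_ge).
  rewrite ler_wpM2l ?exprn_ge0 // lef_pV2 ?posrE ?mulr_gt0 ?sqrtr_gt0 ?ltr0n //.
  by rewrite ler_pM2l // ler_wsqrtr // ler_nat ltnS leq_addr.
- have pow4 : 4 = 2 ^+ 2 :> R by rewrite -natrX.
  apply: le_trans lbound_le _; rewrite pow4 -exprM mul2n -addnn.
  apply: exp_coeff_ge => //.
  by rewrite natrD; lra.
Qed.

Definition density_gap_lbound n : R :=
  expR (density_exponent - 1) / 7200 * decay (sum_inv_primes R n + 1).

Lemma complement_card_ge n (S : {set 'I_n}) : (0 < n)%N -> product_free S ->
  n%:R * density_gap_lbound n <= #|~: S|%:R.
Proof.
case: n S => // n S _ pfS; have totient_lb := totient_ge R (ltn0Sn n).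
have lam_ge0 := sum_inv_primes_ge0 R n.+1.
have [k [k_le lbound_k lbound_2k]] := exp_coeff_double_ge lam_ge0.
have elemsym_ge : (1 - 49 / 50) * exp_coeff (sum_inv_primes R n.+1) (k + k) <=
    elemsym (@inv_prime_divisor n.+1 R) (k + k).
  rewrite -sum_inv_prime_divisor; apply: elemsym_ge_exp_coeff => [i||].
  - exact: inv_prime_divisor_ge0.
  - by lra.
  rewrite sum_inv_prime_divisor.
  apply: le_trans (ler_wpM2l (sqr_ge0 _) (sum_inv_prime_divisor_sqr _ _)) _.
  have := lerXn2r 2 _ _ k_le; rewrite !nnegrE ler0n mulr_ge0 // exprMn.
  by move=> /(_ isT isT); lra.
have eps_ge0 : 0 <= 1 - 49 / 50 :> R by lra.
have lbound_gt0 := exp_coeff_lbound_gt0 lam_ge0.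
have := totient_le_complement pfS eps_ge0 lbound_gt0 elemsym_ge
  lbound_k lbound_k lbound_2k.
rewrite /density_gap_lbound (mulrAC (expR _)) -exp_coeff_lboundE.
have := ler_wpM2l (ltW lbound_gt0) totient_lb; lra.
Qed.

Lemma density_setC n (S : {set 'I_n}) : (0 < n)%N ->
  density R S = 1 - #|~: S|%:R / n%:R.
Proof.
move=> n_gt0.
have cardS : #|S|%:R + #|~: S|%:R = n%:R :> R by rewrite -natrD cardsC card_ord.
rewrite /density -[#|S|%:R](addrK #|~: S|%:R) cardS mulrBl divff //.
by rewrite pnatr_eq0 -lt0n.
Qed.

Lemma max_density_le n : (0 < n)%N ->
  max_density R n <= 1 - density_gap_lbound n.
Proof.
move=> n_gt0.
have density_le (S : {set 'I_n}) : product_free S ->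
    density R S <= 1 - density_gap_lbound n.
  move=> pfS; rewrite density_setC // lerD2l lerN2 ler_pdivlMr ?ltr0n // mulrC.
  exact: complement_card_ge.
apply: bigmax_le => [|S]; last exact: density_le.
have pf0 : product_free (set0 : {set 'I_n}).
  by apply/forall_inP => a; rewrite inE.
by apply: le_trans (density_le _ pf0); rewrite /density cards0 mul0r.
Qed.

Lemma density_gap_lbound_gt : exists2 c : R, 0 < c & forall n, (20 <= n)%N ->
  c / (ln (ln n%:R) `^ density_exponent * Num.sqrt (ln (ln (ln n%:R))))
  < density_gap_lbound n.
Proof.
have [_ lnln20_gt1 _] := iterated_ln_ge20 (lexx (20 : R)).
have L20_gt0 : 0 < ln (ln (ln 20)) :> R by rewrite ln_gt0.
pose K : R := `|mertens_const R| + 1; have K_gt0 : 0 < K by rewrite ltr_wpDl.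
pose c0 : R := expR (density_exponent - 1) / 7200.
pose c1 : R :=
  expR (- (density_exponent * K)) / Num.sqrt (1 + K / ln (ln (ln 20))).
have c0_gt0 : 0 < c0 by rewrite divr_gt0 ?expR_gt0 ?ltr0n.
have c1_gt0 : 0 < c1.
  by rewrite divr_gt0 ?expR_gt0 // sqrtr_gt0 ltr_pwDl // divr_ge0 ?ltW.
exists (c0 * (c1 / 2)) => [|n n_ge20]; first exact: mulr_gt0 (divr_gt0 _ _).
have n_ge20' : 20 <= n%:R :> R by rewrite ler_nat.
have [ln_n_ge2 lnln_n_gt1 L_ge] := iterated_ln_ge20 n_ge20'.
have -> : (ln (ln n%:R) `^ density_exponent * Num.sqrt (ln (ln (ln n%:R))))^-1 =
    decay (ln (ln (ln n%:R))).
  by rewrite invfM /powR gt_eqF -?expRN //; lra.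
rewrite -mulrA /density_gap_lbound ltr_pM2l //.
apply: (@lt_le_trans _ _ (decay (ln (ln (ln n%:R)) + K))).
  apply: lt_le_trans (decayD_ge L20_gt0 L_ge (ltW K_gt0)); rewrite -/c1.
  have := mulr_gt0 c1_gt0 (decay_gt0 (lt_le_trans L20_gt0 L_ge)); lra.
apply: ler_decay; first by rewrite ltr_wpDl ?sum_inv_primes_ge0.
have := sum_inv_primes_le ln_n_ge2; have := ler_norm (mertens_const R).
by rewrite /K; lra.
Qed.

End DensityBound.

Theorem theorem1p1 (R : realType) :
  exists c : R, 0 < c /\
    forall n : nat, (20 <= n)%N ->
      max_density R n <
        1 - c / (ln (ln n%:R) `^ (1 - 1 / 2 * expR 1 * ln 2)
                 * Num.sqrt (ln (ln (ln n%:R)))).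
Proof.
have [c c_gt0 gap_gt] := density_gap_lbound_gt R.
exists c; split=> // n n_ge20; have n_gt0 : (0 < n)%N by lia.
apply: le_lt_trans (max_density_le R n_gt0) _.
by rewrite ltrD2l ltrN2; exact: gap_gt.
Qed.
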